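(* Let $A$ be decomposed into a core $K_0$ and ends $U_1,\dots,U_m$ with exhaustions $h_i$ and admissible weights $\varphi_i$ as in the context. Then $\|\cdot\|^{\sharp}_{\mathbf{h},\boldsymbol{\varphi}}$ is well defined on $C(A)/\mathbb{R}$ (invariant under adding constants), absolutely homogeneous, subadditive, and vanishes only on the class of constants. Hence it is a norm on $\mathcal{A}$.
   Context: $A$ is a non-compact, locally compact, $\sigma$-compact Hausdorff space; $C(A)$ is the space of real continuous functions on $A$ and $C(A)/\mathbb{R}$ its quotient by the constants. Decomposition at infinity: there is a compact $K_0\subset A$ (the core) and finitely many pairwise disjoint, open, connected, non-compact sets $U_1,\dots,U_m$ (the ends) with $A\setminus K_0=\bigsqcup_{i=1}^m U_i$. Each $U_i$ carries a continuous $h_i:U_i\to[0,\infty)$ such that (E1) $\{x\in U_i:h_i(x)\le R\}$ is relatively compact in $A$ for every $R<\infty$; (E2) $h_i$ extends continuously to $\overline{U_i}$ with $h_i\equiv0$ on $\partial U_i\subset K_0$; (E3) $h_i$ is unbounded on $U_i$; (E4) $\partial U_i=\overline{U_i}\setminus U_i\neq\varnothing$. Each end carries an admissible weight $\varphi_i$. Admissible means: $\varphi:[0,\infty)\to[1,\infty)$ is continuous, non-decreasing, $\varphi(0)=1$, and there is $K\ge1$ with $\varphi(r+s)\le K\varphi(r)\varphi(s)$ for all $r,s\ge0$. For $f\in C(A)$: $N_0(f):=\inf_{c\in\mathbb{R}}\sup_{x\in K_0}|f(x)-c|$, $N_i(f):=\inf_{c\in\mathbb{R}}\sup_{x\in U_i}\varphi_i(h_i(x))|f(x)-c|$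 for $i=1,\dots,m$, and $\|[f]\|^{\sharp}_{\mathbf{h},\boldsymbol{\varphi}}:=\max\{N_0(f),N_1(f),\dots,N_m(f)\}\in[0,\infty]$. $\mathcal{A}:=\{[f]\in C(A)/\mathbb{R}:\|[f]\|^{\sharp}_{\mathbf{h},\boldsymbol{\varphi}}<\infty\}$. *)

(* Defs.v *)
From HB Require Import structures.
From mathcomp Require Import all_boot all_order all_algebra.
From mathcomp Require Import generic_quotient ring_quotient.
From mathcomp Require Import all_classical all_reals all_analysis.

Set Implicit Arguments.
Unset Strict Implicit.
Unset Printing Implicit Defensive.

Import Order.TTheory GRing.Theory Num.Theory.
Import numFieldNormedType.Exports.

Local Open Scope classical_set_scope.
Local Open Scope ring_scope.
Local Open Scope quotient_scope.

Section ContinuousFunctions.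
Variables (R : realType) (A : topologicalType).

Definition ctsfun : {pred A -> R} := mem [set f : A -> R | continuous f].

Section Sub.
Variables (f : A -> R) (fP : f \in ctsfun).
Definition ctsfun_Sub_subproof := @isContinuous.Build A R f (set_mem fP).
#[local] HB.instance Definition _ := ctsfun_Sub_subproof.
Definition ctsfun_Sub : continuousType A R := f.
End Sub.

Lemma ctsfun_rect (K : continuousType A R -> Type) :
  (forall f (Pf : f \in ctsfun), K (ctsfun_Sub Pf)) -> forall u, K u.
Proof.
move=> Ksub [f [[Pf]]].
have Pf' : f \in ctsfun by rewrite inE.
have -> : Pf = set_mem Pf' by exact: Prop_irrelevance.
exact: Ksub.
Qed.

Lemma ctsfun_valP f (Pf : f \in ctsfun) : ctsfun_Sub Pf = f :> (A -> R).
Proof. by []. Qed.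

HB.instance Definition _ :=
  isSub.Build (A -> R) ctsfun (continuousType A R) ctsfun_rect ctsfun_valP.


Lemma ctsfun_submod_closed : submod_closed ctsfun.
Proof.
split=> [|a f g]; rewrite !inE /=; first exact: cst_continuous.
by move=> fc gc x; apply: continuousD; [apply: continuousZr|]; [exact: fc|exact: gc].
Qed.

HB.instance Definition _ :=
  GRing.isSubmodClosed.Build R (A -> R) ctsfun ctsfun_submod_closed.

HB.instance Definition _ :=
  [SubChoice_isSubLmodule of continuousType A R by <:].


Definition constC (c : R) : continuousType A R := cst c.

Definition constants : {pred continuousType A R} := mem (range constC).

Lemma constants_submod_closed : submod_closed constants.
Proof.
split=> [|a f g]; rewrite !inE.
  by exists 0 => //; exact/val_inj.
move=> -[c _ <-] [d _ <-]; exists (a * c + d) => //.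
exact/val_inj.
Qed.

HB.instance Definition _ := GRing.isSubmodClosed.Build R (continuousType A R)
  constants constants_submod_closed.

(* The quotient of additive groups C(A)/R. The library only equips it with a
   zmodType structure; the scalar multiplication is added below. *)
Definition contq : Type := Quotient.quot constants.

HB.instance Definition _ := Choice.on contq.
HB.instance Definition _ := GRing.Zmodule.on contq.
HB.instance Definition _ := EqQuotient.on contq.
HB.instance Definition _ := ZmodQuotient.on contq.

Definition contq_scale (a : R) (u : contq) : contq := \pi_contq (a *: repr u).

Lemma contq_piP (f g : continuousType A R) :
  \pi_contq f = \pi_contq g <-> f - g \in constants.
Proof. by rewrite (Quotient.idealrBE constants); split=> /eqP; exact. Qed.

Lemma pi_contq_scale (a : R) (f : continuousType A R) :
  \pi_contq (a *: f) = contq_scale a (\pi_contq f).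
Proof.
apply/contq_piP; rewrite -scalerBr rpredZ//.
by apply/contq_piP; rewrite reprK.
Qed.

Lemma contq_piD : {morph \pi_contq : f g / f + g}.
Proof. exact: raddfD. Qed.

Lemma contq_scaleA (a b : R) (u : contq) :
  contq_scale a (contq_scale b u) = contq_scale (a * b) u.
Proof.
rewrite -[u]reprK -(pi_contq_scale b) -(pi_contq_scale a) scalerA.
exact: pi_contq_scale.
Qed.

Lemma contq_scale1 : left_id 1 contq_scale.
Proof. by move=> u; rewrite /contq_scale scale1r reprK. Qed.

Lemma contq_scaleDr : right_distributive contq_scale +%R.
Proof.
move=> a u v; rewrite /contq_scale -contq_piD -scalerDr.
apply/contq_piP; rewrite -scalerBr rpredZ//.
by apply/contq_piP; rewrite contq_piD !reprK.
Qed.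

Lemma contq_scaleDl (u : contq) : {morph contq_scale^~ u : a b / a + b}.
Proof. by move=> a b; rewrite /contq_scale -contq_piD scalerDl. Qed.

HB.instance Definition _ := GRing.Zmodule_isLmodule.Build R contq
  contq_scaleA contq_scale1 contq_scaleDr contq_scaleDl.

End ContinuousFunctions.
Arguments contq : clear implicits.
Arguments constC {R A} c.

Definition sigma_compact (T : topologicalType) : Prop :=
  exists K : nat -> set T,
    (forall n, compact (K n)) /\ \bigcup_n K n = [set: T].

Section Ends.
Variables (R : realType) (A : topologicalType).

(* Only the values of phi on [0, +oo[ matter. *)
Record admissible (phi : R -> R) : Prop := Admissible {
  adm_continuous : {within `[0, +oo[, continuous phi};
  adm_ge1 : forall r : R, 0 <= r -> 1 <= phi r;
  adm_nondecreasing : {in `[0, +oo[ &, {homo phi : r s / r <= s}};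
  adm_at0 : phi 0 = 1;
  adm_submul : exists2 K : R, 1 <= K &
    forall r s : R, 0 <= r -> 0 <= s -> phi (r + s) <= K * phi r * phi s }.

(* For open U this is the topological boundary of U. *)
Definition bd (U : set A) : set A := closure U `\` U.

(* Only the values of h on U matter. *)
Record is_end (K0 U : set A) (h : A -> R) : Prop := IsEnd {
  end_open : open U;
  end_connected : connected U;
  end_noncompact : ~ compact U;
  exh_continuous : {within U, continuous h};
  exh_ge0 : forall x, U x -> 0 <= h x;
  exh_precompact : forall r : R, precompact (U `&` [set x | h x <= r]);
  exh_extension : exists g : A -> R,
    [/\ {within closure U, continuous g},
        (forall x, U x -> g x = h x) &
        (forall x, bd U x -> g x = 0)];
  end_bd_core : bd U `<=` K0;
  exh_unbounded : ~ has_ubound (h @` U);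
  end_bd_neq0 : bd U !=set0 }.

Record decomposition_at_infinity (K0 : set A) (m : nat) (U : 'I_m -> set A)
    (h : 'I_m -> A -> R) : Prop := DecompositionAtInfinity {
  core_compact : compact K0;
  ends_disjoint : trivIset [set: 'I_m] U;
  ends_cover : ~` K0 = \bigcup_i U i;
  ends_are_ends : forall i, is_end K0 (U i) (h i) }.

Local Open Scope ereal_scope.

Definition N_core (K0 : set A) (f : continuousType A R) : \bar R :=
  ereal_inf [set ereal_sup [set (`|f x - c|%R)%:E | x in K0] | c in [set: R]].

Definition N_end (U : set A) (h : A -> R) (phi : R -> R)
    (f : continuousType A R) : \bar R :=
  ereal_inf [set ereal_sup [set (phi (h x) * `|f x - c|)%R%:E | x in U]
            | c in [set: R]].

Variables (K0 : set A) (m : nat) (U : 'I_m -> set A) (h : 'I_m -> A -> R).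
Variable phi : 'I_m -> R -> R.

Definition sharp (f : continuousType A R) : \bar R :=
  \big[maxe/N_core K0 f]_(i < m) N_end (U i) (h i) (phi i) f.

(* Evaluated on a chosen representative; it agrees with sharp on every
   representative only once sharp is known to be invariant under constants. *)
Definition sharpq (u : contq R A) : \bar R := sharp (repr u).

Definition sharp_space : set (contq R A) := [set u | sharpq u < +oo].

End Ends.

Record is_norm_on (R : realType) (V : lmodType R) (W : set V) (nu : V -> R)
    : Prop := IsNormOn {
  norm_on_subspace : submod_closed (mem W);
  norm_on_ge0 : forall u, W u -> 0 <= nu u;
  norm_on_eq0 : forall u, W u -> nu u = 0 -> u = 0;
  norm_onZ : forall (a : R) u, W u -> nu (a *: u) = `|a| * nu u;
  norm_onD : forall u v, W u -> W v -> nu (u + v) <= nu u + nu v }.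

(* Main.v *)
Require Import Defs.
From HB Require Import structures.
From mathcomp Require Import all_boot all_order all_algebra.
From mathcomp Require Import generic_quotient ring_quotient.
From mathcomp Require Import all_classical all_reals all_analysis.
From mathcomp Require Import lra.

Import Order.TTheory GRing.Theory Num.Theory.
Import numFieldNormedType.Exports.

Local Open Scope classical_set_scope.
Local Open Scope ring_scope.
Local Open Scope quotient_scope.
Local Open Scope ereal_scope.

(* Every term of the maximum is a weighted oscillation inf_c sup_S w |f - c| on
   a nonempty set, with w >= 1. Optimal constants can be shifted, scaled and
   added, which gives invariance, homogeneity and subadditivity, and
   homogeneity follows from the inequality for a and for a^-1. *)
Definition wosc {R : realType} {T : Type} (S : set T) (w f : T -> R) : \bar R :=
  ereal_inf [set ereal_sup [set (w x * `|f x - c|)%R%:E | x in S]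
            | c in [set: R]].

(** * Weighted oscillation on a single set *)

Section WeightedOscillation.
Context {R : realType} {T : Type}.
Variables (S : set T) (w : T -> R).
Implicit Types f g : T -> R.

Lemma wosc_le f (c t : R) :
  (forall x, S x -> w x * `|f x - c| <= t)%R -> wosc S w f <= t%:E.
Proof.
move=> ft; apply: ge_ereal_inf.
exists (ereal_sup [set (w x * `|f x - c|)%R%:E | x in S]); first by exists c.
by apply/ereal_supP => _ [x Sx <-]; rewrite lee_fin ft.
Qed.

(** The infimum over constants is not known to be attained; any [t] strictly above it still admits a
    constant, so the later arguments leave a margin [e]. *)
Lemma wosc_lt f (t : R) : wosc S w f < t%:E ->
  exists c : R, forall x, S x -> (w x * `|f x - c| <= t)%R.
Proof.
move=> /ereal_inf_lt[_ [c _ <-] /ltW /ereal_supP ft].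
by exists c => x Sx; rewrite -lee_fin; apply: ft; exists x.
Qed.

Lemma wosc_shift_le f (c : R) : wosc S w (fun x => f x + c)%R <= wosc S w f.
Proof.
apply: ereal_inf_le_tmp => _ [d _ <-]; exists (d + c)%R => //.
by congr ereal_sup; apply: eq_imagel => x _; rewrite opprD addrACA subrr addr0.
Qed.

Hypothesis w_ge0 : forall x, S x -> (0 <= w x)%R.

(** Nonemptiness matters: a supremum over the empty set is [-oo], and so would be the
    oscillation. *)
Lemma wosc_ge0 f : S !=set0 -> 0 <= wosc S w f.
Proof.
move=> [x Sx]; apply/ereal_infP => _ [c _ <-].
apply: le_ereal_sup_tmp; exists (w x * `|f x - c|)%R%:E; first by exists x.
by rewrite lee_fin mulr_ge0 ?w_ge0.
Qed.

Lemma wosc_scale_le f (a : R) : S !=set0 ->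
  wosc S w (fun x => a * f x)%R <= `|a|%:E * wosc S w f.
Proof.
(* For [a = 0] the right side is 0 even if the oscillation is [+oo]; the constant 0 gives the
   bound. *)
move=> S0; have [->|a0] := eqVneq a 0%R.
  rewrite normr0 mul0e; apply: (@wosc_le _ 0) => x _.
  by rewrite mul0r subr0 normr0 mulr0.
have a_gt0 : (0 < `|a|)%R by rewrite normr_gt0.
have := wosc_ge0 f S0; case E : (wosc S w f) => [r| |] //= _; last first.
  by rewrite gt0_muley ?lte_fin// leey.
apply/lee_addgt0Pr => e e0.
(* The margin is divided by the absolute value of [a] so that it becomes [e] after scaling; [a * c]
   is then the constant for [a * f]. *)
have [|c fc] := @wosc_lt f (r + e / `|a|)%R.
  by rewrite E lte_fin ltrDl divr_gt0.
rewrite -EFinM -EFinD; apply: (@wosc_le _ (a * c)) => x Sx.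
rewrite -mulrBr normrM mulrCA (le_trans (ler_wpM2l (ltW a_gt0) (fc x Sx)))//.
by rewrite mulrDr mulrCA divff ?mulr1 ?normr_eq0.
Qed.

Lemma wosc_add_le f g : S !=set0 ->
  wosc S w (fun x => f x + g x)%R <= wosc S w f + wosc S w g.
Proof.
move=> S0; have := wosc_ge0 f S0; have := wosc_ge0 g S0.
(* Non-negativity excludes [-oo], and one infinite term makes the bound trivial. In the finite case
   near-optimal constants [c] and [d] add up to [c + d]. *)
case Eg : (wosc S w g) => [s| |] // _; case Ef : (wosc S w f) => [r| |] // _;
  rewrite ?leey//.
apply/lee_addgt0Pr => e e0.
have [|c fc] := @wosc_lt f (r + e / 2)%R.
  by rewrite Ef lte_fin ltrDl divr_gt0.
have [|d gd] := @wosc_lt g (s + e / 2)%R.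
  by rewrite Eg lte_fin ltrDl divr_gt0.
rewrite -!EFinD; apply: (@wosc_le _ (c + d)) => x Sx.
have : (`|f x + g x - (c + d)| <= `|f x - c| + `|g x - d|)%R.
  by rewrite opprD addrACA ler_normD.
move=> /(ler_wpM2l (w_ge0 _ Sx)) /le_trans; apply.
by have := fc x Sx; have := gd x Sx; rewrite mulrDr; lra.
Qed.

(** Since weights are at least 1, some constant is within [e / 2] of [f] at both points, so the two
    values differ by at most [e], for every [e]. *)
Lemma wosc_eq0 f : (forall x, S x -> 1 <= w x)%R -> wosc S w f = 0 ->
  forall x y, S x -> S y -> f x = f y.
Proof.
move=> w1 f0 x y Sx Sy; apply/eqP; rewrite -subr_eq0 -normr_le0.
apply/ler_addgt0Pr => e e0.
have [|c fc] := @wosc_lt f (e / 2)%R; first by rewrite f0 lte_fin divr_gt0.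
have near_c z : S z -> (`|f z - c| <= e / 2)%R.
  by move=> Sz; rewrite (le_trans _ (fc z Sz))// ler_peMl ?w1.
rewrite add0r (splitr e) (le_trans (ler_distD c _ _))// lerD ?near_c//.
by rewrite distrC near_c.
Qed.

End WeightedOscillation.

(** The set where [f] equals [c] is closed and contains [U]. *)
Lemma continuous_eq_on_closure {R : realType} {A : topologicalType} (U : set A)
    (f : A -> R) (c : R) :
  continuous f -> (forall x, U x -> f x = c) -> forall x, closure U x -> f x = c.
Proof.
move=> /continuous_closedP/(_ _ (@closed_eq R c)) fc Uc x Ux.
by apply: (fc x); move: x Ux; apply: closureS.
Qed.

Lemma constants_cst {R : realType} {A : topologicalType}
    (f : continuousType A R) (c : R) :
  (forall x, f x = c) -> f \in @constants R A.
Proof.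
by move=> fc; rewrite inE; exists c => //; apply/val_inj/funext => x; exact/esym/fc.
Qed.

(** * The maximum over the core and the ends *)

Section Sharp.
Context {R : realType} {A : topologicalType}.
Context {K0 : set A} {m : nat} {U : 'I_m -> set A}.
Context {h : 'I_m -> A -> R} {phi : 'I_m -> R -> R}.
Hypothesis A_noncompact : ~ compact [set: A].
Hypothesis decomp : decomposition_at_infinity K0 U h.
Hypothesis adm : forall i, admissible (phi i).

Local Notation N := (sharp K0 U h phi).
Local Notation Nq := (sharpq K0 U h phi).
Implicit Types (f g : continuousType A R) (u v : contq R A).

(** End terms are instances of [wosc] by unfolding; the core term has no weight factor and needs the
    weight 1 inserted. *)
Lemma N_coreE f : N_core K0 f = wosc K0 (cst 1%R) f.
Proof.
congr ereal_inf; apply: eq_imagel => c _; congr ereal_sup.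
by apply: eq_imagel => x _; rewrite mul1r.
Qed.

Lemma end_nonempty i : U i !=set0.
Proof.
have [x [Ux _]] := end_bd_neq0 (ends_are_ends decomp i).
(* The whole space is a neighbourhood of the boundary point [x], hence meets the end. *)
by have [y [Uy _]] := Ux setT filterT; exists y.
Qed.

(** Non-compactness makes [A] nonempty. Were the core empty, a point of [A] would lie in some end,
    whose nonempty boundary is contained in the core. *)
Lemma core_nonempty : K0 !=set0.
Proof.
apply/set0P/eqP => K00; have := ends_cover decomp; rewrite K00 setC0 => AU.
have [x _] : [set: A] !=set0.
  by apply/set0P/eqP => A0; apply: A_noncompact; rewrite A0; exact: compact0.
have [i _ _] : (\bigcup_i U i) x by rewrite -AU.
have e := ends_are_ends decomp i; have [y /(end_bd_core e)] := end_bd_neq0 e.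
by rewrite K00.
Qed.

Lemma end_weight_ge1 i x : U i x -> (1 <= phi i (h i x))%R.
Proof.
by move=> Ux; rewrite (adm_ge1 (adm i))// (exh_ge0 (ends_are_ends decomp i)).
Qed.

Lemma end_weight_ge0 i x : U i x -> (0 <= phi i (h i x))%R.
Proof. by move=> /end_weight_ge1; apply: le_trans. Qed.

Lemma core_le_sharp f : N_core K0 f <= N f.
Proof. exact: bigmax_ge_id. Qed.

Lemma end_le_sharp i f : N_end (U i) (h i) (phi i) f <= N f.
Proof. exact: (le_bigmax _ (fun i => N_end (U i) (h i) (phi i) f) i). Qed.

Lemma sharp_ge0 f : 0 <= N f.
Proof.
rewrite (le_trans _ (core_le_sharp f))// N_coreE.
by apply: wosc_ge0 => //; exact: core_nonempty.
Qed.

Lemma sharp_shift f (c : R) : N (f + constC c)%R = N f.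
Proof.
have shift_le g d : N (g + constC d)%R <= N g.
  apply: bigmax_le => [|i _].
    by rewrite (le_trans _ (core_le_sharp g))// !N_coreE; exact: wosc_shift_le.
  by rewrite (le_trans _ (end_le_sharp i g))//; exact: wosc_shift_le.
(* The reverse inequality comes from shifting back by [- c]. *)
apply/le_anti; rewrite shift_le/=.
have {1}-> : f = ((f + constC c) + constC (- c))%R.
  by apply/val_inj/funext => x /=; rewrite -[RHS]/(f x + c - c)%R addrK.
exact: shift_le.
Qed.

Lemma sharp_scale f (a : R) : N (a *: f)%R = `|a|%:E * N f.
Proof.
have scale_le b g : N (b *: g)%R <= `|b|%:E * N g.
  have norm_b : 0 <= `|b|%:E by rewrite lee_fin.
  apply: bigmax_le => [|i _].
    rewrite (le_trans _ (lee_wpmul2l norm_b (core_le_sharp g)))// !N_coreE.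
    by apply: wosc_scale_le => //; exact: core_nonempty.
  rewrite (le_trans _ (lee_wpmul2l norm_b (end_le_sharp i g)))//.
  by apply: wosc_scale_le => [x|]; [exact: end_weight_ge0|exact: end_nonempty].
apply/le_anti; rewrite scale_le/=.
(* At [a = 0], which has no inverse, the reverse inequality is just non-negativity. *)
have [->|a0] := eqVneq a 0%R; first by rewrite normr0 mul0e sharp_ge0.
rewrite -lee_pdivlMl ?normr_gt0//.
by have := scale_le a^-1%R (a *: f)%R; rewrite scalerA mulVf// scale1r normfV.
Qed.

Lemma sharp_add f g : N (f + g)%R <= N f + N g.
Proof.
apply: bigmax_le => [|i _].
  rewrite (le_trans _ (leeD (core_le_sharp f) (core_le_sharp g)))// !N_coreE.
  by apply: wosc_add_le => //; exact: core_nonempty.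
rewrite (le_trans _ (leeD (end_le_sharp i f) (end_le_sharp i g)))//.
by apply: wosc_add_le => [x|]; [exact: end_weight_ge0|exact: end_nonempty].
Qed.

(* The constants that f takes on the core and on an end agree because the
   boundary of the end is nonempty and lies in the core. *)
Lemma sharp_eq0 f : N f = 0 -> f \in @constants R A.
Proof.
move=> f0; have [k K0k] := core_nonempty.
have core_cst x : K0 x -> f x = f k.
  move=> K0x; apply: (@wosc_eq0 _ _ K0 (cst 1%R)) => //.
  (* The core term is squeezed between 0 and the vanishing maximum. *)
  apply/le_anti; rewrite wosc_ge0//; last by exists k.
  by rewrite andbT -f0 -N_coreE core_le_sharp.
apply: (@constants_cst _ _ _ (f k)) => x.
have [|K0x] := pselect (K0 x); first exact: core_cst.
have [i _ Ux] : (\bigcup_i U i) x by rewrite -(ends_cover decomp).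
have e := ends_are_ends decomp i; have [y bdy] := end_bd_neq0 e.
rewrite -(core_cst y (end_bd_core e bdy)); apply/esym.
(* The constant here is [f x]: it is the value of [f] on the whole end, and continuity carries it to
   the boundary point [y]. *)
apply: (@continuous_eq_on_closure _ _ (U i)); last by case: bdy.
  exact: cts_fun.
move=> z Uz; apply: (@wosc_eq0 _ _ (U i) (phi i \o h i)) => //.
- exact: end_weight_ge1.
- apply/le_anti; apply/andP; split; first by rewrite -f0; exact: end_le_sharp.
  by apply: wosc_ge0 => [t|]; [exact: end_weight_ge0|exact: end_nonempty].
Qed.

(** * Passage to classes modulo constants *)

(** The chosen representative differs from [f] by a constant, so shift invariance applies. *)
Lemma sharpq_pi f : Nq (\pi_(contq R A) f) = N f.
Proof.
have : (repr (\pi_(contq R A) f) - f)%R \in @constants R A.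
  by apply/contq_piP; rewrite reprK.
rewrite inE => -[c _ fc]; rewrite /sharpq -(sharp_shift f c) fc.
by rewrite addrC subrK.
Qed.

Lemma sharpq_ge0 u : 0 <= Nq u.
Proof. exact: sharp_ge0. Qed.

Lemma sharpq_scale (a : R) u : Nq (a *: u)%R = `|a|%:E * Nq u.
Proof.
rewrite -[u]reprK -[LHS]/(Nq (contq_scale a _)) -pi_contq_scale.
by rewrite !sharpq_pi sharp_scale.
Qed.

Lemma sharpq_add u v : Nq (u + v)%R <= Nq u + Nq v.
Proof. by rewrite -[u]reprK -[v]reprK -contq_piD !sharpq_pi sharp_add. Qed.

Lemma sharpq_eq0 u : Nq u = 0 -> u = 0%R.
Proof.
move=> /sharp_eq0 u0; rewrite -[u]reprK -(raddf0 (\pi_(contq R A))).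
by apply/contq_piP; rewrite subr0.
Qed.

Lemma sharpq_fin u : sharp_space K0 U h phi u -> Nq u \is a fin_num.
Proof. by move=> uA; rewrite ge0_fin_numE// sharpq_ge0. Qed.

(** On this space all values are finite, so [fine] loses nothing and the extended-real laws become
    real ones. *)
Lemma sharp_norm : is_norm_on (sharp_space K0 U h phi) (fine \o Nq).
Proof.
have Nq0 : Nq 0%R = 0.
  by rewrite -(scale0r (0 : contq R A)%R) sharpq_scale normr0 mul0e.
split.
- split=> [|a u v]; rewrite !inE /sharp_space /=; first by rewrite Nq0 ltry.
  move=> uA vA; rewrite (le_lt_trans (sharpq_add _ _))// sharpq_scale.
  by rewrite lte_add_pinfty// lte_mul_pinfty// ?lee_fin ?sharpq_fin.
- by move=> u _; rewrite fine_ge0 ?sharpq_ge0.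
- move=> u /sharpq_fin uA u0; apply: sharpq_eq0.
  by rewrite -(fineK uA); congr EFin.
- by move=> a u /sharpq_fin uA /=; rewrite sharpq_scale fineM.
- move=> u v /sharpq_fin uA /sharpq_fin vA /=.
  rewrite -fineD// fine_le ?fin_numD ?uA ?vA//; last exact: sharpq_add.
  (* Monotonicity of [fine] also requires the value at [u + v] to be finite; subadditivity bounds it
     by a finite sum. *)
  rewrite ge0_fin_numE ?sharpq_ge0// (le_lt_trans (sharpq_add _ _))//.
  by rewrite ltey_eq fin_numD uA vA.
Qed.

End Sharp.

Theorem proposition8p6 (R : realType) (A : topologicalType)
    (A_noncompact : ~ compact [set: A])
    (A_locally_compact : locally_compact [set: A])
    (A_sigma_compact : sigma_compact A)
    (A_hausdorff : hausdorff_space A)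
    (K0 : set A) (m : nat) (U : 'I_m -> set A)
    (h : 'I_m -> A -> R) (phi : 'I_m -> R -> R)
    (A_decomposition : decomposition_at_infinity K0 U h)
    (phi_admissible : forall i, admissible (phi i)) :
  let N := sharp K0 U h phi in
  let Nq := sharpq K0 U h phi in
  let calA := sharp_space K0 U h phi in
  (forall (f : continuousType A R) (c : R), N (f + constC c)%R = N f) /\
  (forall f : continuousType A R, Nq (\pi_(contq R A) f) = N f) /\
  (forall u : contq R A, 0 <= Nq u) /\
  (forall (a : R) (u : contq R A), Nq (a *: u)%R = `|a|%:E * Nq u) /\
  (forall u v : contq R A, Nq (u + v)%R <= Nq u + Nq v) /\
  (forall u : contq R A, Nq u = 0 -> u = 0%R) /\
  (forall u : contq R A, calA u -> Nq u \is a fin_num) /\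
  is_norm_on calA (fine \o Nq).
Proof.
move=> N Nq calA; split; first exact: sharp_shift.
split; first exact: sharpq_pi.
split; first exact: sharpq_ge0.
split; first exact: sharpq_scale.
split; first exact: sharpq_add.
split; first exact: sharpq_eq0.
split; [exact: sharpq_fin|exact: sharp_norm].
Qed.
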